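(* If $(\mathbf{X}^*,\mathbf{y}^*,\mathbf{Z}^*,\mathbf{P}^* )$ is the $(\mathbf{X},\mathbf{y},\mathbf{Z},\mathbf{P})$-part of an optimal solution of problem (JDPEW-MISOCP), then $(\mathbf{X}^*,\mathbf{y}^*,\mathbf{Z}^*,\mathbf{P}^* )$ is also optimal for problem (JDPEW). Both problems are defined in the context.
   Context: Sets: $\mathcal{M}=\{1,\dots,m\}$ (product/customer groups), $\mathcal{W}=\{1,\dots,w\}$ (subsystems), $\mathcal{N}=\{1,\dots,n\}$ with $n=2^w-1$ (potential contracts, each a combination of subsystems), $\mathcal{L}=\{1,\dots,l\}$ (discount levels). Parameters: $\mathbb{I}_{ik}\in\{0,1\}$ equals 1 iff contract $i$ includes subsystem $k$; $\lambda_j$ is the proportion of group-$j$ customers, $\sum_{j}\lambda_j=1$; $F_{kj}$ is the failure probability and $c_{kj}$ the failure cost of subsystem $k$ for group $j$; $P^0_{kj}$ is the initial price of subsystem $k$ for group $j$; $d_1>\dots>d_l$ are the discount levels (multipliers of the price; a smaller $d_h$ is a larger discount); $\theta$ is the advertising cost of a contract; $v_{kj}$ is the attraction value of subsystem $k$ for group $j$; $\beta_j>0$ is the price sensitivity of group $j$; $u_{0j}$ is the preference weight of the outside option for group $j$. Decision variables: $\mathbf{X}=(x_{ij})$, $\mathbf{y}=(y_i)$, $\mathbf{Z}=(z_{ih})$ binary, $\mathbf{P}=(p_{ij})$ with $p_{ij}\ge0$; $\mathbf{x}_j=\{x_{ij}\}_{i\in\mathcal{N}}$, $\mathbf{p}_j=\{p_{ij}\}_{i\in\mathcal{N}}$.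 Choice model: the preference weight of contract $i$ for group $j$ is $u_{ij}(p_{ij})=\sum_{k}\mathbb{I}_{ik}v_{kj}-\beta_jp_{ij}$, and the probability that a group-$j$ customer chooses contract $i$ is $$q_{ij}(\mathbf{p}_j,\mathbf{x}_j)=\frac{\sum_{k\in\mathcal{W}}\mathbb{I}_{ik}v_{kj}-\beta_jp_{ij}}{u_{0j}+\sum_{i'\in\mathcal{N}}\big[\sum_{k\in\mathcal{W}}\mathbb{I}_{i'k}v_{kj}-\beta_jp_{i'j}\big]x_{i'j}}\,x_{ij}.$$ Problem (JDPEW): maximize $$\sum_{j\in\mathcal{M}}\lambda_j\sum_{i\in\mathcal{N}}q_{ij}(\mathbf{p}_j,\mathbf{x}_j)\Big[p_{ij}-\sum_{k\in\mathcal{W}}\mathbb{I}_{ik}F_{kj}c_{kj}\Big]-\sum_{i\in\mathcal{N}}\theta y_i$$ subject to the following constraints, called the base constraints: (B1) $x_{ij}\le y_i$ for all $i\in\mathcal N,j\in\mathcal M$; (B2) $\sum_{i\in\mathcal{N}}\mathbb{I}_{ik}x_{ij}\ge1$ for all $k\in\mathcal W,j\in\mathcal M$; (B3) $\sum_{h\in\mathcal{L}}z_{ih}=1$ for all $i\in\mathcal N$; (B4) $\big(\sum_{h}z_{ih}d_h-\sum_{h'}z_{i'h'}d_{h'}\big)\big(\sum_{k}\mathbb{I}_{ik}-\sum_{k}\mathbb{I}_{i'k}\big)\le0$ for all $i,i'\in\mathcal N$; (B5) $p_{ij}=\big(\sum_k\mathbb{I}_{ik}P^0_{kj}\big)\big(\sum_h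 z_{ih}d_h\big)$ for all $i\in\mathcal N,j\in\mathcal M$; (B6) $y_i,x_{ij},z_{ih}\in\{0,1\}$, $p_{ij}\ge0$ for all $i\in\mathcal N,j\in\mathcal M,h\in\mathcal L$. Notation: $\hat V_{ij}=\sum_k\mathbb{I}_{ik}v_{kj}$, $\hat P_{ij}=\sum_k\mathbb{I}_{ik}P^0_{kj}$, $\hat C_{ij}=\sum_k\mathbb{I}_{ik}F_{kj}c_{kj}$, $\hat R_j=\max_{i\in\mathcal{N}}\{\hat P_{ij}-\hat C_{ij}\}$, $t_j^L=1/(u_{0j}+\sum_{i\in\mathcal{N}}\hat V_{ij})$, $t_j^U=1/u_{0j}$. Problem (JDPEW-MISOCP): over the variables $x_{ij},y_i,z_{ih},p_{ij}$ and the additional real variables $t_j,w_j,s_{ijh},g_{ij},o_{ijh}$ ($i\in\mathcal N,j\in\mathcal M,h\in\mathcal L$), minimize $$\sum_{j}\lambda_ju_{0j}\hat R_jt_j+\sum_{i}\theta y_i+\sum_j\lambda_j\sum_i\hat V_{ij}\Big[\hat R_jg_{ij}-\hat P_{ij}\Big(\sum_ho_{ijh}d_h\Big)+\hat C_{ij}g_{ij}\Big]$$ $$+\sum_j\lambda_j\sum_i\beta_j\hat P_{ij}\Big[-\hat R_j\Big(\sum_ho_{ijh}d_h\Big)+\hat P_{ij}\Big(\sum_ho_{ijh}d_h^2\Big)-\Big(\sum_ho_{ijh}d_h\Big)\hat C_{ij}\Big]$$ subject to the base constraints (B1)-(B6) and, for all $i\in\mathcal N,j\in\mathcal M,h\in\mathcal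 L$: $t_j\ge0$, $w_j\ge0$, $w_jt_j\ge1$; $w_j=u_{0j}+\sum_{i\in\mathcal{N}}\big[\hat V_{ij}x_{ij}-\beta_j\hat P_{ij}\big(\sum_hs_{ijh}d_h\big)\big]$; $s_{ijh}\ge z_{ih}+(x_{ij}-1)$, $s_{ijh}\ge0$, $s_{ijh}\le z_{ih}$, $s_{ijh}\le x_{ij}$; $g_{ij}\ge t_j+(x_{ij}-1)t_j^U$, $g_{ij}\ge x_{ij}t_j^L$, $g_{ij}\le t_j+(x_{ij}-1)t_j^L$, $g_{ij}\le x_{ij}t_j^U$; $o_{ijh}\ge s_{ijh}t_j^L$, $o_{ijh}\ge t_j+(s_{ijh}-1)t_j^U$, $o_{ijh}\le t_j+(s_{ijh}-1)t_j^L$, $o_{ijh}\le s_{ijh}t_j^U$.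
   Formalization: Added, since the claim fails without them: all preference weights u_ij(p_ij) are nonnegative at every design satisfying the base constraints, and R̂_j ≥ 0 for every group j. Also made explicit: u_0j > 0, λ_j ≥ 0, initial prices nonnegative, discount multipliers d_h ≤ 1. *)

(* Defs.v *)
(* Numbers live in an arbitrary realFieldType (in particular the real
   numbers): only field operations, order and finite maxima occur. *)
From mathcomp Require Import all_boot all_order all_algebra.

Set Implicit Arguments.
Unset Strict Implicit.
Unset Printing Implicit Defensive.

Import Order.TTheory GRing.Theory Num.Theory.
Local Open Scope ring_scope.

Definition ncontracts (w : nat) : nat := (2 ^ w - 1)%N.

(* Dimensions: m customer groups, w subsystems, l discount levels. *)
Record instance (R : realFieldType) (m w l : nat) : Type := Instance {
  contract : 'I_(ncontracts w) -> {set 'I_w};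
  lam : 'I_m -> R;
  failp : 'I_w -> 'I_m -> R;         (* F_kj *)
  fcost : 'I_w -> 'I_m -> R;         (* c_kj *)
  price0 : 'I_w -> 'I_m -> R;        (* P^0_kj *)
  disc : 'I_l -> R;                  (* d_h *)
  theta : R;
  attr : 'I_w -> 'I_m -> R;          (* v_kj *)
  beta : 'I_m -> R;
  uout : 'I_m -> R                   (* u_0j *)
}.

(* The binary variables are booleans, read as 0/1 numbers through b%:R. *)
Record design (R : realFieldType) (m w l : nat) : Type := Design {
  dx : 'I_(ncontracts w) -> 'I_m -> bool;
  dy : 'I_(ncontracts w) -> bool;
  dz : 'I_(ncontracts w) -> 'I_l -> bool;
  dp : 'I_(ncontracts w) -> 'I_m -> R
}.

Record auxvars (R : realFieldType) (m w l : nat) : Type := Auxvars {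
  at_ : 'I_m -> R;
  aw : 'I_m -> R;
  as_ : 'I_(ncontracts w) -> 'I_m -> 'I_l -> R;
  ag : 'I_(ncontracts w) -> 'I_m -> R;
  ao : 'I_(ncontracts w) -> 'I_m -> 'I_l -> R
}.

(* Maximum of a sequence.  The starting value is the first element rather than
   0, so this is the true maximum of every nonempty sequence, including one
   whose elements are all negative. *)
Definition seqmax (R : realFieldType) (s : seq R) : R :=
  \big[Num.max/head 0 s]_(r <- s) r.

Section Problems.
Variables (R : realFieldType) (m w l : nat).
Variable D : instance R m w l.

Local Notation N := 'I_(ncontracts w).

Definition inc (i : N) (k : 'I_w) : R := (k \in contract D i)%:R.

Definition Vhat (i : N) (j : 'I_m) : R := \sum_k inc i k * attr D k j.
Definition Phat (i : N) (j : 'I_m) : R := \sum_k inc i k * price0 D k j.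
Definition Chat (i : N) (j : 'I_m) : R :=
  \sum_k inc i k * failp D k j * fcost D k j.
Definition Rhat (j : 'I_m) : R :=
  seqmax [seq Phat i j - Chat i j | i <- enum 'I_(ncontracts w)].
Definition tL (j : 'I_m) : R := 1 / (uout D j + \sum_i Vhat i j).
Definition tU (j : 'I_m) : R := 1 / uout D j.

Definition prefweight (i : N) (j : 'I_m) (p : R) : R :=
  \sum_k inc i k * attr D k j - beta D j * p.

Definition choiceprob (i : N) (j : 'I_m) (p : N -> R) (x : N -> bool) : R :=
  prefweight i j (p i)
    / (uout D j + \sum_i' prefweight i' j (p i') * (x i')%:R) * (x i)%:R.

Definition discof (a : design R m w l) (i : N) : R :=
  \sum_h (dz a i h)%:R * disc D h.

(* Integrality of x, y and z is built into their type. *)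
Record base_feasible (a : design R m w l) : Prop := BaseFeasible {
  offer_sold : forall i j, ((dx a i j)%:R : R) <= (dy a i)%:R;
  cover : forall k j, 1 <= \sum_i inc i k * (dx a i j)%:R;
  one_level : forall i, \sum_h ((dz a i h)%:R : R) = 1;
  disc_monotone : forall i i',
    (discof a i - discof a i') * (\sum_k inc i k - \sum_k inc i' k) <= 0;
  price_eq : forall i j,
    dp a i j = (\sum_k inc i k * price0 D k j) * discof a i;
  price_ge0 : forall i j, 0 <= dp a i j
}.

Definition jdpew_obj (a : design R m w l) : R :=
  \sum_j lam D j *
     \sum_i choiceprob i j (fun i' => dp a i' j) (fun i' => dx a i' j)
            * (dp a i j - \sum_k inc i k * failp D k j * fcost D k j)
  - \sum_i theta D * (dy a i)%:R.

Definition jdpew_optimal (a : design R m w l) : Prop :=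
  base_feasible a /\
  forall a', base_feasible a' -> jdpew_obj a' <= jdpew_obj a.

Definition misocp_obj (a : design R m w l) (e : auxvars R m w l) : R :=
  \sum_j lam D j * uout D j * Rhat j * at_ e j
  + \sum_i theta D * (dy a i)%:R
  + \sum_j lam D j * (\sum_i Vhat i j *
      (Rhat j * ag e i j - Phat i j * (\sum_h ao e i j h * disc D h)
       + Chat i j * ag e i j))
  + \sum_j lam D j * (\sum_i beta D j * Phat i j *
      (- Rhat j * (\sum_h ao e i j h * disc D h)
       + Phat i j * (\sum_h ao e i j h * disc D h ^+ 2)
       - (\sum_h ao e i j h * disc D h) * Chat i j)).

Record misocp_feasible (a : design R m w l) (e : auxvars R m w l) : Prop :=
  MisocpFeasible {
  misocp_base : base_feasible a;
  t_ge0 : forall j, 0 <= at_ e j;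
  w_ge0 : forall j, 0 <= aw e j;
  wt_ge1 : forall j, 1 <= aw e j * at_ e j;
  w_eq : forall j, aw e j = uout D j +
    \sum_i (Vhat i j * (dx a i j)%:R
            - beta D j * Phat i j * (\sum_h as_ e i j h * disc D h));
  s_geD : forall i j h, (dz a i h)%:R + ((dx a i j)%:R - 1) <= as_ e i j h;
  s_ge0 : forall i j h, 0 <= as_ e i j h;
  s_lez : forall i j h, as_ e i j h <= (dz a i h)%:R;
  s_lex : forall i j h, as_ e i j h <= (dx a i j)%:R;
  g_geU : forall i j, at_ e j + ((dx a i j)%:R - 1) * tU j <= ag e i j;
  g_geL : forall i j, (dx a i j)%:R * tL j <= ag e i j;
  g_leL : forall i j, ag e i j <= at_ e j + ((dx a i j)%:R - 1) * tL j;
  g_leU : forall i j, ag e i j <= (dx a i j)%:R * tU j;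
  o_geL : forall i j h, as_ e i j h * tL j <= ao e i j h;
  o_geU : forall i j h, at_ e j + (as_ e i j h - 1) * tU j <= ao e i j h;
  o_leL : forall i j h, ao e i j h <= at_ e j + (as_ e i j h - 1) * tL j;
  o_leU : forall i j h, ao e i j h <= as_ e i j h * tU j
}.

Definition misocp_optimal (a : design R m w l) (e : auxvars R m w l) : Prop :=
  misocp_feasible a e /\
  forall a' e', misocp_feasible a' e' -> misocp_obj a e <= misocp_obj a' e'.

(* Since there are 2 ^ w - 1 contracts, the two conditions on [contract] say
   that it enumerates the nonempty combinations of subsystems. *)
Record parameter_domain : Prop := ParameterDomain {
  w_gt0 : (0 < w)%N;
  contract_inj : injective (contract D);
  contract_neq0 : forall i, contract D i != set0;
  lam_ge0 : forall j, 0 <= lam D j;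
  lam_sum : \sum_j lam D j = 1;
  failp_prob : forall k j, 0 <= failp D k j <= 1;
  price0_ge0 : forall k j, 0 <= price0 D k j;
  disc_decr : forall h h' : 'I_l, (h < h')%N -> disc D h' < disc D h;
  disc_le1 : forall h, disc D h <= 1;
  beta_gt0 : forall j, 0 < beta D j;
  uout_gt0 : forall j, 0 < uout D j
}.

(* Well-posedness of the attraction model: at the prices of every feasible
   design all preference weights are nonnegative, so that the choice
   probabilities are genuine probabilities. *)
Definition prefweights_nonneg : Prop :=
  forall a, base_feasible a -> forall i j, 0 <= prefweight i j (dp a i j).

(* For every group some contract does not lose money at its undiscounted
   price.  Otherwise the coefficient of t_j in the conic objective can be
   negative, and w_j t_j >= 1 need not be tight at an optimum. *)
Definition Rhat_nonneg : Prop := forall j, 0 <= Rhat j.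

End Problems.

(* Main.v *)
Require Import Defs.
From mathcomp Require Import all_boot all_order all_algebra.
From mathcomp Require Import ring lra.

(** Write [W j] for the denominator of the choice probabilities of group [j]
    ([denom]) and [G j] for the sum over the offered contracts of weight times
    margin ([weighted_margin]), so that group [j] contributes [G j / W j] to the profit.

    The linear constraints of the conic problem are McCormick envelopes of
    products with one binary factor.  Such envelopes are exact: they force
    [s = z x], [g = x t] and [o = z x t], hence also [w = W].  Since a contract
    uses a single discount level, the sum of [z d ^+ 2] is the square of the
    sum of [z d], and the conic objective collapses to
    [\sum_j lam j * (Rhat j * W j - G j) * t j + \sum_i theta * y i].

    The bracket is [uout j * Rhat j] plus the weights of the offered contracts
    times [Rhat j] minus their margin.  It is nonnegative: discounting cannot
    raise a margin above [Rhat j], and weights are nonnegative.  As the cone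
    constraint says [t j >= 1 / W j], the conic objective is at least
    [\sum_j lam j * Rhat j] minus the profit ([misocp_obj_ge]).  Conversely
    every base feasible design attains this value with [t j = 1 / W j]
    ([misocp_obj_exact]); this choice respects the bounds [tL j] and [tU j] on
    [t j], because [W j] lies between [uout j] and the denominator in which
    every contract is offered for free.  Minimizing the conic objective is
    therefore maximizing the profit. *)

Set Implicit Arguments.
Unset Strict Implicit.
Unset Printing Implicit Defensive.

Import Order.TTheory GRing.Theory Num.Theory.
Local Open Scope ring_scope.

Section Envelopes.
Variable R : realFieldType.

Lemma le_seqmax (s : seq R) (x : R) : x \in s -> x <= seqmax s.
Proof. by move=> xs; exact: (le_bigmax_seq _ x xpredT id xs). Qed.

Lemma mccormick_bool_eq (b : bool) (lo up t g : R) :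
  t + (b%:R - 1) * up <= g -> b%:R * lo <= g ->
  g <= t + (b%:R - 1) * lo -> g <= b%:R * up -> g = b%:R * t.
Proof. by case: b => /=; lra. Qed.

(** The bounds on [t] are needed even when the product vanishes: at
    [b = false] the envelope reads [t - up <= 0 <= t - lo]. *)
Lemma mccormick_bool_feasible (b : bool) (lo up t : R) : lo <= t <= up ->
  [/\ t + (b%:R - 1) * up <= b%:R * t, b%:R * lo <= b%:R * t,
      b%:R * t <= t + (b%:R - 1) * lo & b%:R * t <= b%:R * up].
Proof. by case/andP => ? ?; case: b; split=> /=; lra. Qed.

Lemma mccormick_andb_eq (b c : bool) (s : R) :
  b%:R + (c%:R - 1) <= s -> 0 <= s -> s <= b%:R -> s <= c%:R ->
  s = (b && c)%:R.
Proof. by case: b; case: c => /=; lra. Qed.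

(** The equation holds in the field, but characteristic zero turns it into a
    count of the indices where [z] is true. *)
Lemma one_hot (I : finType) (z : I -> bool) :
  \sum_h ((z h)%:R : R) = 1 -> exists h0, forall h, z h = (h == h0).
Proof.
move=> /eqP; rewrite -natr_sum -[1]/(1%:R) eqr_nat => /eqP sz.
have /card1P[h0 zh0] : #|z| == 1%N.
  rewrite -sum1_card big_mkcond -[X in _ == X]sz; apply/eqP.
  by apply: eq_bigr => h _; rewrite unfold_in; case: (z h).
by exists h0 => h; have := zh0 h; rewrite !inE unfold_in.
Qed.

Lemma sum_one_hot (I : finType) (h0 : I) (z : I -> bool) (f : I -> R) :
  (forall h, z h = (h == h0)) -> \sum_h (z h)%:R * f h = f h0.
Proof.
move=> zE; rewrite (bigD1 h0) //= zE eqxx mul1r big1 ?addr0 // => h /negPf hh.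
by rewrite zE hh mul0r.
Qed.

End Envelopes.

Section Equivalence.
Variables (R : realFieldType) (m w l : nat) (D : instance R m w l).
Implicit Types (a : design R m w l) (e : auxvars R m w l).

Definition denom a j : R :=
  uout D j + \sum_i prefweight D i j (dp a i j) * (dx a i j)%:R.

Definition weighted_margin a j : R :=
  \sum_i prefweight D i j (dp a i j) * (dx a i j)%:R * (dp a i j - Chat D i j).

Definition ad_cost a : R := \sum_i theta D * (dy a i)%:R.

Lemma jdpew_objE a :
  jdpew_obj D a =
  \sum_j lam D j * (weighted_margin a j / denom a j) - ad_cost a.
Proof.
rewrite /jdpew_obj; congr (_ - _); apply: eq_bigr => j _; congr (_ * _).
rewrite /weighted_margin mulr_suml; apply: eq_bigr => i _.
by rewrite /choiceprob -/(denom a j) -/(Chat D i j); ring.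
Qed.

Definition products_exact a e : Prop :=
  [/\ forall i j h, as_ e i j h = (dz a i h && dx a i j)%:R,
      forall i j, ag e i j = (dx a i j)%:R * at_ e j
    & forall i j h, ao e i j h = (dz a i h && dx a i j)%:R * at_ e j].

Lemma products_exact_of_feasible a e :
  misocp_feasible D a e -> products_exact a e.
Proof.
case=> _ _ _ _ _ s1 s2 s3 s4 g1 g2 g3 g4 o1 o2 o3 o4.
have sE i j h : as_ e i j h = (dz a i h && dx a i j)%:R.
  exact: mccormick_andb_eq.
split=> // [i j|i j h]; first exact: (mccormick_bool_eq (g1 i j) (g2 i j)).
apply: (@mccormick_bool_eq _ _ (tL D j) (tU D j)); by rewrite -?sE.
Qed.

Lemma sum_level_offered a i j (t : R) (f : 'I_l -> R) :
  \sum_h (dz a i h && dx a i j)%:R * t * f h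
  = (dx a i j)%:R * t * \sum_h (dz a i h)%:R * f h.
Proof.
rewrite mulr_sumr; apply: eq_bigr => h _.
by rewrite -mulnb natrM; ring.
Qed.

Lemma prefweightE a i j : base_feasible D a ->
  prefweight D i j (dp a i j)
  = Vhat D i j - beta D j * (Phat D i j * discof D a i).
Proof. by move=> fa; rewrite /prefweight (price_eq fa). Qed.

Lemma denomE a (s : 'I_(ncontracts w) -> 'I_m -> 'I_l -> R) j :
    base_feasible D a ->
    (forall i h, s i j h = (dz a i h && dx a i j)%:R) ->
  uout D j + \sum_i (Vhat D i j * (dx a i j)%:R
    - beta D j * Phat D i j * (\sum_h s i j h * disc D h)) = denom a j.
Proof.
move=> fa sE; congr (_ + _); apply: eq_bigr => i _.
under eq_bigr => h _ do rewrite sE -[_%:R]mulr1.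
by rewrite sum_level_offered -/(discof D a i) prefweightE //; ring.
Qed.

(** Only one level is selected, so the cross terms of the square vanish. *)
Lemma discof_sqr a i : base_feasible D a ->
  \sum_h (dz a i h)%:R * disc D h ^+ 2 = discof D a i ^+ 2.
Proof.
move=> fa; have [h0 zE] := one_hot (one_level fa i).
by rewrite /discof !(sum_one_hot _ zE).
Qed.

Lemma conic_coefE a j :
  Rhat D j * denom a j - weighted_margin a j
  = Rhat D j * uout D j
    + \sum_i prefweight D i j (dp a i j) * (dx a i j)%:R
        * (Rhat D j - (dp a i j - Chat D i j)).
Proof.
rewrite /denom /weighted_margin mulrDr mulr_sumr -addrA -sumrB.
by congr (_ + _); apply: eq_bigr => i _; ring.
Qed.

(** Once the products are exact, the last two groups of terms factor as
    [(Vhat - beta * p) * (Rhat - p + Chat)] times [x * t]. *)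
Lemma misocp_obj_collapse a e : base_feasible D a -> products_exact a e ->
  misocp_obj D a e =
  \sum_j lam D j * ((Rhat D j * denom a j - weighted_margin a j) * at_ e j)
  + ad_cost a.
Proof.
move=> fa [_ gE oE]; rewrite /misocp_obj -/(ad_cost a).
rewrite -!addrA [ad_cost a + _]addrC !addrA; congr (_ + _).
rewrite -!big_split /=; apply: eq_bigr => j _.
rewrite -!mulrA -!mulrDr; congr (_ * _).
rewrite conic_coefE mulrDl mulr_suml -addrA -big_split /=.
congr (_ + _); first by ring.
apply: eq_bigr => i _; rewrite gE.
have oS f : \sum_h ao e i j h * f h
    = (dx a i j)%:R * at_ e j * \sum_h (dz a i h)%:R * f h.
  by under eq_bigr => h _ do rewrite oE; exact: sum_level_offered.
rewrite !oS discof_sqr // -/(discof D a i).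
rewrite prefweightE //.
by rewrite (price_eq fa) -/(Phat D i j); ring.
Qed.

Hypotheses (hD : parameter_domain D) (hu : prefweights_nonneg D).

Lemma discof_le1 a i : base_feasible D a -> discof D a i <= 1.
Proof.
move=> fa; have [h0 zE] := one_hot (one_level fa i).
by rewrite /discof (sum_one_hot _ zE) (disc_le1 hD).
Qed.

(** Discount multipliers are at most one, so the margin is largest at the
    undiscounted price. *)
Lemma margin_le_Rhat a i j : base_feasible D a ->
  dp a i j - Chat D i j <= Rhat D j.
Proof.
move=> fa; apply: (@le_trans _ _ (Phat D i j - Chat D i j)).
  rewrite lerB // (price_eq fa) ler_piMr ?discof_le1 //.
  by apply: sumr_ge0 => k _; rewrite mulr_ge0 ?ler0n ?(price0_ge0 hD).
by apply: le_seqmax; apply/mapP; exists i; rewrite ?mem_enum.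
Qed.

Lemma denom_ge_uout a j : base_feasible D a -> uout D j <= denom a j.
Proof.
move=> fa; rewrite lerDl; apply: sumr_ge0 => i _.
by rewrite mulr_ge0 ?ler0n ?hu.
Qed.

Lemma denom_gt0 a j : base_feasible D a -> 0 < denom a j.
Proof. by move=> fa; apply: lt_le_trans (denom_ge_uout j fa); apply: uout_gt0. Qed.

(** Offering a further contract adds a nonnegative weight, and lowering a price
    to zero raises a weight because prices and sensitivities are nonnegative. *)
Lemma denom_le_free a j : base_feasible D a ->
  denom a j <= uout D j + \sum_i Vhat D i j.
Proof.
move=> fa; rewrite lerD2l; apply: ler_sum => i _.
have u0 := hu fa i j.
have uV : prefweight D i j (dp a i j) <= Vhat D i j.
  by rewrite gerBl mulr_ge0 ?(price_ge0 fa) // ltW ?(beta_gt0 hD).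
by case: (dx a i j); rewrite ?mulr1 ?mulr0 // (le_trans u0).
Qed.

Lemma inv_denom_bounds a j : base_feasible D a ->
  tL D j <= (denom a j)^-1 <= tU D j.
Proof.
move=> fa; rewrite /tL /tU !div1r.
have W0 := denom_gt0 j fa; have u0 := uout_gt0 hD j.
rewrite !lef_pV2 ?posrE ?denom_le_free ?denom_ge_uout //.
exact: lt_le_trans W0 (denom_le_free j fa).
Qed.

Lemma conic_coef_ge0 a j : Rhat_nonneg D -> base_feasible D a ->
  0 <= Rhat D j * denom a j - weighted_margin a j.
Proof.
move=> hR fa; rewrite conic_coefE addr_ge0 //.
  by rewrite mulr_ge0 ?hR // ltW // (uout_gt0 hD).
apply: sumr_ge0 => i _; rewrite !mulr_ge0 ?ler0n ?hu //.
by rewrite subr_ge0 margin_le_Rhat.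
Qed.

Definition exact_aux a : auxvars R m w l :=
  let t j := (denom a j)^-1 in
  Auxvars t (denom a)
    (fun i j h => (dz a i h && dx a i j)%:R)
    (fun i j => (dx a i j)%:R * t j)
    (fun i j h => (dz a i h && dx a i j)%:R * t j).

Lemma exact_aux_feasible a :
  base_feasible D a -> misocp_feasible D a (exact_aux a).
Proof.
move=> fa; have W0 j := denom_gt0 j fa.
have env b j := mccormick_bool_feasible b (inv_denom_bounds j fa).
split=> //=.
- by move=> j; rewrite invr_ge0 ltW.
- by move=> j; rewrite ltW.
- by move=> j; rewrite divff ?gt_eqF.
- by move=> j; exact: esym (@denomE a (as_ (exact_aux a)) j fa _).
- by move=> i j h; case: (dz a i h); case: (dx a i j) => /=; lra.
- by move=> i j h; case: (dz a i h); case: (dx a i j) => /=; lra.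
- by move=> i j h; case: (dz a i h); case: (dx a i j) => /=; lra.
- by move=> i j; case: (env (dx a i j) j).
- by move=> i j; case: (env (dx a i j) j).
- by move=> i j; case: (env (dx a i j) j).
- by move=> i j; case: (env (dx a i j) j).
- by move=> i j h; case: (env (dz a i h && dx a i j) j).
- by move=> i j h; case: (env (dz a i h && dx a i j) j).
- by move=> i j h; case: (env (dz a i h && dx a i j) j).
- by move=> i j h; case: (env (dz a i h && dx a i j) j).
Qed.

Lemma conic_value_at_inv_denom a : base_feasible D a ->
  \sum_j lam D j * ((Rhat D j * denom a j - weighted_margin a j) / denom a j)
  + ad_cost a = \sum_j lam D j * Rhat D j - jdpew_obj D a.
Proof.
move=> fa; rewrite jdpew_objE opprB addrCA -sumrB addrC; congr (_ + _).
apply: eq_bigr => j _; rewrite mulrBl mulfK ?mulrBr //.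
by rewrite gt_eqF ?denom_gt0.
Qed.

Lemma misocp_obj_exact a : base_feasible D a ->
  misocp_obj D a (exact_aux a) = \sum_j lam D j * Rhat D j - jdpew_obj D a.
Proof.
by move=> fa; rewrite misocp_obj_collapse // conic_value_at_inv_denom.
Qed.

(** Each coefficient of [t j] is nonnegative, so replacing [t j] by its lower
    bound [1 / denom a j] cannot increase the objective. *)
Lemma misocp_obj_ge a e : Rhat_nonneg D -> misocp_feasible D a e ->
  \sum_j lam D j * Rhat D j - jdpew_obj D a <= misocp_obj D a e.
Proof.
move=> hR fe; have fa := misocp_base fe.
have ex := products_exact_of_feasible fe; have [sE _ _] := ex.
rewrite -conic_value_at_inv_denom // misocp_obj_collapse // lerD2r.
apply: ler_sum => j _; rewrite ler_wpM2l ?(lam_ge0 hD) //.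
rewrite ler_wpM2l ?conic_coef_ge0 //.
have := wt_ge1 fe j; rewrite (w_eq fe) denomE //.
by rewrite -ler_pdivrMl ?mulr1 ?denom_gt0.
Qed.

End Equivalence.

Theorem proposition2 (R : realFieldType) (m w l : nat) (D : instance R m w l)
    (hD : parameter_domain D)
    (hu : prefweights_nonneg D)
    (hR : Rhat_nonneg D)
    (a : design R m w l) (e : auxvars R m w l)
    (hopt : misocp_optimal D a e) :
  jdpew_optimal D a.
Proof.
have [fe opt] := hopt; split=> [|a' fa']; first exact: misocp_base fe.
have := opt a' _ (exact_aux_feasible hD hu fa').
rewrite misocp_obj_exact // => /(le_trans (misocp_obj_ge hD hu hR fe)).
by rewrite lerD2l lerN2.
Qed.
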